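(* Let $P$ be any finite poset and let $p\in P$. Then the toggleability statistic $\mathfrak{T}_p$ is homomesic with average value $0$ (that is, $0$-mesic) with respect to rowmotion: for every orbit $\mathcal{O}\subseteq J(P)$ of the bijection $\mathrm{Row}:J(P)\to J(P)$, $$\frac{1}{|\mathcal{O}|}\sum_{I\in\mathcal{O}}\mathfrak{T}_p(I)=0.$$
   Context: For a finite poset $P$, an order ideal is a subset $I\subseteq P$ such that $p\in I$ and $q\le p$ imply $q\in I$; $J(P)$ denotes the set of all order ideals of $P$. For $X\subseteq P$, $X_{\max}$ and $X_{\min}$ denote the sets of maximal and minimal elements of $X$, respectively. The order ideal generated by an antichain $A$ is the unique order ideal $I$ with $I_{\max}=A$, i.e. $\{q\in P : q\le a \text{ for some } a\in A\}$. Rowmotion is the bijection $\mathrm{Row}:J(P)\to J(P)$ for which $\mathrm{Row}(I)$ is the order ideal generated by the antichain $(P\setminus I)_{\min}$. For $p\in P$, the toggleability statistic $\mathfrak{T}_p:J(P)\to\{-1,0,1\}$ is defined by $\mathfrak{T}_p(I)=1$ if $p\in(P\setminus I)_{\min}$, $\mathfrak{T}_p(I)=-1$ if $p\in I_{\max}$, and $\mathfrak{T}_p(I)=0$ otherwise. Given a finite set $X$, an invertible map $\tau:X\to X$ and a statistic $f:X\to\mathbb{Z}$, $f$ is called homomesic with average value $c$ (or $c$-mesic) with respect to $\tau$ if $\frac{1}{|\mathcal{O}|}\sum_{x\in\mathcal{O}}f(x)=c$ for every $\tau$-orbit $\mathcal{O}\subseteq X$. *)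

(* Defs.v *)
From HB Require Import structures.
From mathcomp Require Import all_boot all_order all_algebra all_fingroup.

Set Implicit Arguments.
Unset Strict Implicit.
Unset Printing Implicit Defensive.

Import Order.TTheory GRing.Theory Num.Theory.

Section Poset.
Variables (d : Order.disp_t) (P : finPOrderType d).
Implicit Types (X A I : {set P}) (p q : P).

Definition maxs X : {set P} := [set x in X | [forall y in X, ~~ (x < y)%O]].
Definition mins X : {set P} := [set x in X | [forall y in X, ~~ (y < x)%O]].

Definition is_order_ideal I : bool :=
  [forall p in I, forall q, (q <= p)%O ==> (q \in I)].

Record orderIdeal := OrderIdeal {
  ideal_set :> {set P};
  ideal_setP : is_order_ideal ideal_set }.

HB.instance Definition _ := [isSub for ideal_set].
HB.instance Definition _ := [Finite of orderIdeal by <:].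

Definition down_set A : {set P} := [set q | [exists a in A, (q <= a)%O]].

Lemma down_set_is_order_ideal A : is_order_ideal (down_set A).
Proof.
apply/forall_inP => p; rewrite inE => /exists_inP[a aA le_pa].
apply/forallP => q; apply/implyP => le_qp.
by rewrite inE; apply/exists_inP; exists a => //; apply: le_trans le_pa.
Qed.

Definition generated_ideal A : orderIdeal :=
  OrderIdeal (down_set_is_order_ideal A).

Definition row_fun (I : orderIdeal) : orderIdeal :=
  generated_ideal (mins (~: I)).

Lemma mins_antichain X x y :
  x \in mins X -> y \in mins X -> (x <= y)%O -> x = y.
Proof.
rewrite !inE => /andP[xX _] /andP[_ /forall_inP/(_ x xX) nlt_xy].
by rewrite le_eqVlt (negbTE nlt_xy) orbF => /eqP.
Qed.

Lemma maxs_down_set_mins X : maxs (down_set (mins X)) = mins X.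
Proof.
apply/setP => x; apply/idP/idP.
- rewrite inE => /andP[]; rewrite inE => /exists_inP[a aA].
  rewrite le_eqVlt => /orP[/eqP->//|lt_xa] /forall_inP/(_ a).
  rewrite lt_xa => /(_ _)/negP[] //.
  by rewrite inE; apply/exists_inP; exists a.
- move=> xA; rewrite inE; apply/andP; split.
    by rewrite inE; apply/exists_inP; exists x.
  apply/forall_inP => y; rewrite inE => /exists_inP[a aA le_ya].
  apply/negP => lt_xy; have lt_xa := lt_le_trans lt_xy le_ya.
  by move: (lt_xa); rewrite (mins_antichain xA aA (ltW lt_xa)) ltxx.
Qed.

Lemma exists_mins_le X x : x \in X -> exists2 m, m \in mins X & (m <= x)%O.
Proof.
have [n] := ubnP #|[set y | (y < x)%O]|; elim: n x => // n IHn x le_xn xX.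
have [xm|] := boolP (x \in mins X); first by exists x.
rewrite inE xX /= negb_forall_in => /exists_inP[y yX /negPn lt_yx].
have ltyn : #|[set z | (z < y)%O]| < n.
  rewrite ltnS in le_xn; apply: leq_trans le_xn; apply: proper_card; apply/properP; split.
    by apply/subsetP => z; rewrite !inE => /lt_trans; apply.
  by exists y; rewrite !inE ?ltxx.
have [m mA le_my] := IHn y ltyn yX.
by exists m => //; apply: le_trans le_my (ltW lt_yx).
Qed.

Lemma setC_ideal_mins (I : orderIdeal) x :
  (x \in ~: I) = [exists m in mins (~: I), (m <= x)%O].
Proof.
apply/idP/exists_inP => [/exists_mins_le[m]|[m]]; first by exists m.
rewrite inE => /andP[+ _] le_mx; rewrite !inE; apply: contra => xI.
have /forall_inP/(_ x xI)/forallP/(_ m) := ideal_setP I.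
by rewrite le_mx.
Qed.

Lemma row_fun_inj : injective row_fun.
Proof.
move=> I J /(congr1 (fun K : orderIdeal => maxs K)) /=.
rewrite !maxs_down_set_mins => eq_mins.
apply: val_inj; apply: setC_inj; apply/setP => x /=.
by rewrite !setC_ideal_mins eq_mins.
Qed.

Definition rowmotion : {perm orderIdeal} := perm row_fun_inj.

Definition toggleability p (I : orderIdeal) : int :=
  if p \in mins (~: I) then 1%R else if p \in maxs I then (-1)%R else 0%R.

End Poset.

Definition homomesic (X : finType) (tau : {perm X}) (f : X -> int) (c : rat)
    : Prop :=
  forall O : {set X}, O \in porbits tau ->
    (#|O|%:R^-1 * (\sum_(x in O) f x)%:~R = c)%R.

(* Main.v *)
Require Import Defs.
From mathcomp Require Import all_boot all_order all_algebra all_fingroup.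

(** The minimal elements of the complement of [I] are the maximal elements of
    [Row I], so the toggleability of [p] is the coboundary [f (Row I) - f I] of
    the indicator [f] of [p] being maximal, and it sums to zero over each
    orbit. *)

Import GRing.Theory.
Local Open Scope ring_scope.

(** [tau] restricts to a bijection of each of its orbits, so it only permutes the terms of the
    sum. *)
Lemma sum_porbit_perm (V : nmodType) (X : finType) (tau : {perm X})
    (f : X -> V) (O : {set X}) :
  O \in porbits tau -> \sum_(x in O) f (tau x) = \sum_(x in O) f x.
Proof.
case/imsetP=> y _ ->; rewrite [RHS](reindex_inj (@perm_inj _ tau)) /=.
(* Symmetry turns membership in the orbit of [y] into membership of [y] in the orbits of [x] and
   [tau x], which coincide. *)
apply: eq_bigl => x; rewrite !(porbit_sym _ _ y).
by have := porbit_perm tau 1 x; rewrite expg1 => ->.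
Qed.

Lemma homomesic_coboundary (X : finType) (tau : {perm X}) (f : X -> int) :
  homomesic tau (fun x => f (tau x) - f x) 0.
Proof. by move=> O tauO; rewrite sumrB sum_porbit_perm // subrr mulr0. Qed.

Lemma toggleability_coboundary (d : Order.disp_t) (P : finPOrderType d) (p : P)
    (I : orderIdeal P) :
  toggleability p I =
    (p \in maxs (rowmotion P I))%:R - (p \in maxs I)%:R.
Proof.
rewrite permE maxs_down_set_mins /toggleability.
have [pC | _] := boolP (p \in mins _); last by case: ifP.
(* Here [p] lies outside [I], so it is not maximal in [I] and the difference is [1 - 0]. *)
suff /negbTE-> : p \notin maxs I by [].
by apply: contraL pC; rewrite !inE => /andP[-> _].
Qed.

Theorem lemma6p2 (d : Order.disp_t) (P : finPOrderType d) (p : P) :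
  homomesic (rowmotion P) (toggleability p) 0%R.
Proof.
move=> O rowO; under eq_bigr do rewrite toggleability_coboundary.
exact: (homomesic_coboundary _ _ (fun I : orderIdeal P => (p \in maxs I)%:R)).
Qed.
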